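(* No 2-step nilpotent Lie algebra whose commutator has dimension one, two or four can be endowed with an ad-invariant metric.
   Context: All Lie algebras are real and finite dimensional. A metric on a real vector space is a non-degenerate symmetric bilinear form (of any signature). A metric on a Lie algebra $\mathfrak g$ is ad-invariant if $\langle [x,y],z\rangle+\langle y,[x,z]\rangle=0$ for all $x,y,z\in\mathfrak g$. A Lie algebra $\mathfrak n$ is 2-step nilpotent if $[\mathfrak n,[\mathfrak n,\mathfrak n]]=0$ and $[\mathfrak n,\mathfrak n]\ne0$; its commutator is $[\mathfrak n,\mathfrak n]$. *)

(* Defs.v *)
From HB Require Import structures.
From mathcomp Require Import all_boot all_order all_algebra.
From mathcomp Require Import reals.

Set Implicit Arguments.
Unset Strict Implicit.
Unset Printing Implicit Defensive.

Import GRing.Theory.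
Local Open Scope ring_scope.

(* Finite-dimensional Lie algebras: finite dimensionality comes from the
   underlying vectType. *)
HB.mixin Record Vector_isLieAlgebra (F : fieldType) L of Vector F L := {
  lie_bracket : {bilinear L -> L -> L};
  lie_alternating : forall x : L, lie_bracket x x = 0;
  lie_jacobi : forall x y z : L,
    lie_bracket x (lie_bracket y z) + lie_bracket y (lie_bracket z x)
      + lie_bracket z (lie_bracket x y) = 0
}.

#[short(type="lieAlgType")]
HB.structure Definition LieAlgebra (F : fieldType) :=
  { L of Vector_isLieAlgebra F L & Vector F L }.

Declare Scope lie_scope.
Delimit Scope lie_scope with lie.
Notation "[ x , y ]" := (lie_bracket x y)
  (at level 0, x at level 99, y at level 99,
   format "[ x ,  y ]") : lie_scope.
Local Open Scope lie_scope.

Section LieProduct.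
Variables (F : fieldType) (L : lieAlgType F).
Implicit Types U V W : {vspace L}.

(* The subspace [U, V] spanned by all brackets [x, y] with x in U and y in V,
   as for the product of subspaces of an algebra; lie_prodv_subP shows that
   the choice of bases is immaterial. *)
Definition lie_prodv U V : {vspace L} :=
  <<[seq [x, y] | x <- vbasis U, y <- vbasis V]>>%VS.

Lemma memv_lie U V x y : x \in U -> y \in V -> [x, y] \in lie_prodv U V.
Proof.
move=> /coord_vbasis-> /coord_vbasis->.
rewrite linear_sumlz; apply: memv_suml => i _.
rewrite linear_sumr; apply: memv_suml => j _.
rewrite linearZlr !memvZ //; apply: memv_span.
by apply/allpairsP; exists ((vbasis U)`_i, (vbasis V)`_j); rewrite !memt_nth.
Qed.

Lemma lie_prodv_subP U V W :
  reflect (forall x y, x \in U -> y \in V -> [x, y] \in W)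
          (lie_prodv U V <= W)%VS.
Proof.
apply: (iffP idP) => [/subvP sUVW x y xU yV | UVW].
  exact/sUVW/memv_lie.
apply/span_subvP => _ /allpairsP[[x y] /= [xU yV ->]].
by apply: UVW; apply: vbasis_mem.
Qed.

End LieProduct.

Definition commutator (F : fieldType) (L : lieAlgType F) : {vspace L} :=
  lie_prodv fullv fullv.

Definition two_step_nilpotent (F : fieldType) (L : lieAlgType F) : Prop :=
  lie_prodv fullv (commutator L) = 0%VS /\ commutator L <> 0%VS.

Definition ad_invariant (F : fieldType) (L : lieAlgType F)
    (f : {symmetric L}) : Prop :=
  forall x y z : L, f [x, y] z + f y [x, z] = 0.

(* A metric is a nondegenerate symmetric bilinear form, of any signature. *)
Definition has_ad_invariant_metric (F : fieldType) (L : lieAlgType F) : Prop :=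
  exists f : {symmetric L}, nondegenerate f /\ ad_invariant f.

(* Main.v *)
Require Import Defs.
From mathcomp Require Import all_boot all_order all_algebra.
From mathcomp Require Import reals.
From mathcomp Require Import ring.

(* The 3-form T(x, y, z) = <[x, y], z> is alternating, and its radical is the
   center, which is the orthogonal of the commutator. Hence T descends to a
   nondegenerate alternating 3-form on a space of the same dimension m as the
   commutator. For m <= 2 it vanishes; for m = 4 it is the contraction of a
   volume form with a vector v, and v lies in the radical. In both cases T = 0,
   so that the Lie algebra is abelian. *)

Set Implicit Arguments.
Unset Strict Implicit.
Unset Printing Implicit Defensive.

Import GRing.Theory.

Section AdInvariantMetric.
Local Open Scope ring_scope.
Local Open Scope lie_scope.

Variables (F : fieldType) (L : lieAlgType F) (f : {symmetric L}).
Implicit Types (x y z v : L) (b : seq L).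

Lemma lie_skew x y : [x, y] = - [y, x].
Proof.
have := lie_alternating (x + y).
rewrite linearDl !linearDr !lie_alternating add0r addr0 => /eqP.
by rewrite addr_eq0 => /eqP.
Qed.

Lemma formC x y : f x y = f y x.
Proof. by rewrite hermC expr0 mul1r. Qed.

Hypotheses (ndf : nondegenerate f) (adf : ad_invariant f).

Lemma form_eq0 x : (forall y, f x y = 0) -> x = 0.
Proof.
move=> fx0; apply/eqP; rewrite -memv0 -(eqP ndf).
by apply/mem_orthovP => y _.
Qed.

(** Ad-invariance moves the bracket to the other side of [f]; with skew-symmetry this becomes cyclic
    invariance, which makes the 3-form alternating. *)
Lemma form_lie_cyc x y z : f [x, y] z = f [y, z] x.
Proof.
rewrite lie_skew linearNl [RHS]formC; apply/eqP.
by rewrite eq_sym -addr_eq0 addrC adf.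
Qed.

Lemma form_lie_skew x y z : f [x, y] z = - f [y, x] z.
Proof. by rewrite lie_skew linearNl. Qed.

Lemma form_lie_xx x z : f [x, x] z = 0.
Proof. by rewrite lie_alternating linear0l. Qed.

Lemma form_lie_xyy x y : f [x, y] y = 0.
Proof. by rewrite form_lie_cyc form_lie_xx. Qed.

Lemma form_lie_xyx x y : f [x, y] x = 0.
Proof. by rewrite form_lie_skew form_lie_xyy oppr0. Qed.

(** Cyclicity turns the pairing of [v] with [[y, z]] into that of [[v, y]] with [z], and
    nondegeneracy of [f] concludes. *)
Lemma mem_orthov_commutator v :
  reflect (forall y, [v, y] = 0) (v \in orthov f (commutator L)).
Proof.
apply: (iffP idP) => [/mem_orthovP v_orth y | v0].
  apply: form_eq0 => z; rewrite form_lie_cyc formC v_orth //.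
  by apply: memv_lie; apply: memvf.
have: (commutator L <= orthov f <[v]>)%VS.
  apply/lie_prodv_subP => x y _ _; rewrite mem_orthov1.
  by rewrite -form_lie_cyc v0 linear0l.
by rewrite orthov_sym -memvE.
Qed.

(** The matrix of pairings of [b] with a basis of [L] has independent rows, as a combination of [b]
    orthogonal to all of [L] is zero. The columns of a right inverse are the coordinates of [e]. *)
Lemma dual_family b : free b ->
  exists2 e : seq L, size e = size b &
    forall i j, (j < size b)%N -> f e`_i b`_j = (i == j)%:R.
Proof.
move=> freeb; set m := size b; pose u := vbasis (fullv : {vspace L}).
pose A := \matrix_(j < m, k < \dim {:L}) f b`_j u`_k.
have: row_free A.
  apply: inj_row_free => c cA0.
  have: \sum_(j < m) c 0 j *: b`_j = 0.
    apply: form_eq0 => y; rewrite (coord_vbasis (memvf y)).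
    rewrite linear_sumr big1 // => k _.
    rewrite linearZr linear_sumlz /=.
    have /rowP/(_ k) := cA0; rewrite !mxE => cAk.
    rewrite (_ : \sum_(_ < _) _ = 0) ?mulr0 // -[RHS]cAk.
    by apply: eq_bigr => j _; rewrite linearZl_LR mxE.
  have free_tb : free (in_tuple b) by [].
  move/(freeP free_tb) => c0.
  by apply/rowP => j; rewrite c0 mxE.
case/row_freeP => B AB1.
exists [tuple \sum_k B k i *: u`_k | i < m] => [|i j lt_jm].
  exact: size_tuple.
have [lt_im | le_mi] := ltnP i m; last first.
  rewrite nth_default ?size_tuple // linear0l.
  by rewrite gtn_eqF // (leq_trans lt_jm).
have /matrixP/(_ (Ordinal lt_jm) (Ordinal lt_im)) := AB1; rewrite !mxE.
rewrite (nth_mktuple _ 0 (Ordinal lt_im)) linear_sumlz.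
rewrite -[i == j]/(Ordinal lt_im == Ordinal lt_jm) eq_sym => <-.
by apply: eq_bigr => k _; rewrite linearZl_LR mxE mulrC formC.
Qed.

Definition slice_form (e : nat -> L) i j k := f [e i, e j] (e k).

(* The 3-form spanned on e_0, ..., e_3 is the contraction of the volume form
   e^0 ^ e^1 ^ e^2 ^ e^3 with this vector. *)
Definition contraction_vector (e : nat -> L) : L :=
  slice_form e 1 2 3 *: e 0 - slice_form e 0 2 3 *: e 1
    + slice_form e 0 1 3 *: e 2 - slice_form e 0 1 2 *: e 3.

(** Bundled as one multi-rule, so that a single rewrite sorts any permutation of a triple. *)
Lemma form_lie_perm x y z :
  (f [y, x] z = - f [x, y] z) * (f [x, z] y = - f [x, y] z) *
  (f [y, z] x = f [x, y] z) * (f [z, x] y = f [x, y] z) *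
  (f [z, y] x = - f [x, y] z).
Proof.
have cyc1 : f [y, z] x = f [x, y] z by rewrite -form_lie_cyc.
have cyc2 : f [z, x] y = f [x, y] z by rewrite form_lie_cyc.
by do !split; rewrite // form_lie_skew ?cyc1 ?cyc2.
Qed.

(** Contracting a volume form twice with the same vector gives zero. *)
Lemma contraction_vector_radical (e : nat -> L) i j : (i < 4)%N -> (j < 4)%N ->
  f [contraction_vector e, e i] (e j) = 0.
Proof.
rewrite /contraction_vector /slice_form !(linearDl, linearNl, linearZl_LR) /=.
(* The index of each rule is the one that its triple omits. *)
have P3 := form_lie_perm (e 0) (e 1) (e 2).
have P2 := form_lie_perm (e 0) (e 1) (e 3).
have P1 := form_lie_perm (e 0) (e 2) (e 3).
have P0 := form_lie_perm (e 1) (e 2) (e 3).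
by case: i => [|[|[|[|]]]] // _; case: j => [|[|[|[|]]]] // _;
   rewrite ?(form_lie_xx, form_lie_xyx, form_lie_xyy, P0, P1, P2, P3); ring.
Qed.

Lemma slice_form_eq0 (e : nat -> L) :
    slice_form e 0 1 2 = 0 -> slice_form e 0 1 3 = 0 ->
    slice_form e 0 2 3 = 0 -> slice_form e 1 2 3 = 0 ->
  forall i j k, (i < 4)%N -> (j < 4)%N -> (k < 4)%N -> slice_form e i j k = 0.
Proof.
rewrite /slice_form => T3 T2 T1 T0 i j k.
have P3 := form_lie_perm (e 0) (e 1) (e 2).
have P2 := form_lie_perm (e 0) (e 1) (e 3).
have P1 := form_lie_perm (e 0) (e 2) (e 3).
have P0 := form_lie_perm (e 1) (e 2) (e 3).
by case: i => [|[|[|[|]]]] // _; case: j => [|[|[|[|]]]] // _;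
   case: k => [|[|[|[|]]]] // _;
   rewrite ?(form_lie_xx, form_lie_xyx, form_lie_xyy, P0, P1, P2, P3);
   rewrite ?(T0, T1, T2, T3) ?oppr0.
Qed.

(** The [e i] span [L] modulo the center, so centrality can be tested on them alone. *)
Lemma lie_slice_eq0 n (e : nat -> L) v :
    (forall x, exists c : nat -> F,
       x - \sum_(i < n) c i *: e i \in orthov f (commutator L)) ->
    (forall i j, (i < n)%N -> (j < n)%N -> f [v, e i] (e j) = 0) ->
  forall y, [v, y] = 0.
Proof.
move=> slice v_rad.
have rad_span x w z : (forall i, (i < n)%N -> f [x, e i] w = 0) -> f [x, z] w = 0.
  have [c /mem_orthov_commutator c0] := slice z => x0.
  rewrite -[z](subrK (\sum_(i < n) c i *: e i)) linearDr linearDl /= lie_skew c0.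
  rewrite oppr0 linear0l add0r linear_sumr linear_sumlz big1 // => i _.
  by rewrite linearZr_LR linearZl_LR /= x0 ?mulr0.
move=> y; apply: form_eq0 => z; apply: (rad_span v z y) => i lt_in.
(* Rotating the triple brings [z] into the bracket with [v], where [rad_span] applies again. *)
rewrite 2!form_lie_cyc form_lie_skew rad_span ?oppr0 // => j lt_jn.
exact: v_rad.
Qed.

(* Beyond the size of b, the default value 0 of nth kills the extra summands;
   this treats families of fewer than four vectors as families of four. *)
Lemma orthov_dual_family (b e : seq L) m x :
    (size b <= m)%N ->
    (forall i j, (j < size b)%N -> f e`_i b`_j = (i == j)%:R) ->
  x - \sum_(i < m) f x b`_i *: e`_i \in orthov f <<b>>%VS.
Proof.
move=> le_bm dual_e; rewrite memvE orthov_sym.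
apply/span_subvP => y /(nthP 0)[j lt_jb <-].
rewrite mem_orthov1 formC linearBl linear_sumlz.
rewrite (bigD1 (Ordinal (leq_trans lt_jb le_bm))) //= linearZl_LR /= dual_e //.
rewrite eqxx mulr1 big1 ?addr0 ?subrr // => i ne_ij.
by rewrite linearZl_LR /= dual_e // (negPf (_ : (i : nat) != j)) ?mulr0.
Qed.

Lemma commutator_eq0_of_dim :
    \dim (commutator L) = 1%N \/ \dim (commutator L) = 2%N \/
      \dim (commutator L) = 4%N ->
  commutator L = 0%VS.
Proof.
set m := \dim _ => dimC; pose b := vbasis (commutator L).
have sz_b : size b = m by rewrite size_tuple.
have span_b : <<b>>%VS = commutator L := span_basis (vbasisP _).
have [e sz_e dual_e] := dual_family (basis_free (vbasisP (commutator L))).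
pose en i := e`_i; pose v := contraction_vector en.
have le_b4 : (size b <= 4)%N by rewrite sz_b; case: dimC => [|[]] ->.
have slice x : exists c : nat -> F,
    x - \sum_(i < 4) c i *: en i \in orthov f (commutator L).
  exists (fun i => f x b`_i).
  by have := orthov_dual_family x le_b4 dual_e; rewrite span_b.
have v0 : v \in orthov f (commutator L).
  apply/mem_orthov_commutator/(lie_slice_eq0 slice) => i j.
  exact: contraction_vector_radical.
have [T012 T013 T023 T123] : [/\ slice_form en 0 1 2 = 0, slice_form en 0 1 3 = 0,
    slice_form en 0 2 3 = 0 & slice_form en 1 2 3 = 0].
  case: (leqP m 2) => [le_m2 | lt_2m].
    (* Here [en 2] and [en 3] are the default value 0, and every increasing triple of indices below
       4 contains 2 or 3. *)
    have en0 i : (2 <= i)%N -> en i = 0.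
      by move=> le_2i; rewrite /en nth_default // sz_e sz_b (leq_trans le_m2).
    by rewrite /slice_form (en0 2%N) ?(en0 3%N) // !linear0r.
  have sz_b4 : size b = 4%N.
    by rewrite sz_b; case: dimC lt_2m => [|[]] ->.
  (* Being central, [v] is orthogonal to the basis [b] of the commutator; by duality these pairings
     are its coefficients on [en], which are the values of the 3-form up to sign. *)
  have coord_v j : (j < 4)%N -> slice_form en 1 2 3 * (0%N == j)%:R
      - slice_form en 0 2 3 * (1%N == j)%:R + slice_form en 0 1 3 * (2%N == j)%:R
      - slice_form en 0 1 2 * (3%N == j)%:R = 0.
    move=> lt_j4; have <- : f v b`_j = 0.
      by apply: (mem_orthovP v0); rewrite vbasis_mem // mem_nth // sz_b4.
    rewrite !(linearDl, linearNl, linearZl_LR) /=.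
    by rewrite !dual_e ?sz_b4.
  move: (coord_v 0%N isT) (coord_v 1%N isT) (coord_v 2%N isT) (coord_v 3%N isT).
  rewrite /= !(mulr0, mulr1, oppr0, subr0, add0r, addr0, sub0r).
  move=> -> /eqP; rewrite oppr_eq0 => /eqP-> -> /eqP.
  by rewrite oppr_eq0 => /eqP->.
have T0 := slice_form_eq0 T012 T013 T023 T123.
(* The 3-form now vanishes on the slice, so each [en i] is central, and then so is every [x]. *)
have en_central i y : (i < 4)%N -> [en i, y] = 0.
  by move=> lt_i4; apply: (lie_slice_eq0 slice) => j k; apply: T0.
apply/eqP; rewrite -subv0; apply/lie_prodv_subP => x y _ _.
rewrite memv0; apply/eqP/(lie_slice_eq0 slice) => i j lt_i4 _.
by rewrite lie_skew en_central // oppr0 linear0l.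
Qed.

End AdInvariantMetric.

Theorem mainTheorem2 (R : realType) (n : lieAlgType R) :
  two_step_nilpotent n ->
  \dim (commutator n) = 1 \/ \dim (commutator n) = 2 \/
    \dim (commutator n) = 4 ->
  ~ has_ad_invariant_metric n.
Proof.
move=> [_ C_neq0] dimC [f [ndf adf]]; case: C_neq0.
exact: commutator_eq0_of_dim ndf adf dimC.
Qed.
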